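(* Let $\langle F,E\rangle$ be a $w^*$-sequentially complete anti-dual pair and let $A,B\in\mathscr{L}_+(E,F)$ be positive operators. Put $C:=A+B$, let $\mathcal{H}_C$ and $J_C:\mathcal{H}_C\to F$ be the Hilbert space and embedding operator associated with $C$, let $\widetilde{A},\widetilde{B}$ be the positive contractions on $\mathcal{H}_C$ with $A=J_C\widetilde{A}J_C^*$ and $B=J_C\widetilde{B}J_C^*$, and let $P_{\mathcal{M}}$ be the orthogonal projection of $\mathcal{H}_C$ onto $\mathcal{M}:=\ker\widetilde{A}$. Let $B_s$ be the strong limit of the sequence $(B_n)$ given by $B_0:=B$, $B_{n+1}:=B_n-B_n:A$. Then $$[A]B=J_C(\widetilde{B}-P_{\mathcal{M}})J_C^*=B-B_s,$$ where $[A]B$ is the (maximal) $A$-absolutely continuous part of $B$.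
   Context: An anti-dual pair $\langle F,E\rangle$ consists of complex vector spaces $E,F$ and a map $\langle\cdot,\cdot\rangle:F\times E\to\mathbb{C}$, linear in the first and conjugate-linear in the second variable, that separates the points of both $E$ and $F$. It is $w^*$-sequentially complete if for every sequence $(f_n)$ in $F$ such that $(\langle f_n,x\rangle)_n$ is Cauchy for every $x\in E$ there is $f\in F$ with $\langle f_n,x\rangle\to\langle f,x\rangle$ for every $x\in E$. $E$ and $F$ carry the weak topologies induced by each other. A linear operator $A:E\to F$ is positive if $\langle Ax,x\rangle\ge 0$ for all $x\in E$; $\mathscr{L}_+(E,F)$ is the set of positive operators (they are automatically weakly continuous). $S\le T$ means $\langle Sx,x\rangle\le\langle Tx,x\rangle$ for all $x\in E$. For $A,B\in\mathscr{L}_+(E,F)$ the parallel sum $A:B$ is the unique positive operator with $\langle (A:B)x,x\rangle=\inf\{\langle A(x-y),x-y\rangle+\langle By,y\rangle : y\in E\}$ for all $x\in E$; it always exists, is commutative, and satisfies $A:B\le A$, $A:B\le B$. The sequence $(B_n)$ consists of positive operators, and its strong limit $B_s\in\mathscr{L}_+(E,F)$, characterized by $\langle B_nx,y\rangle\to\langle B_sx,y\rangle$ for all $x,y\in E$, exists. For $C\in\mathscr{L}_+(E,F)$, $\mathcal{H}_C$ is the Hilbert space completion of $\operatorname{ran}C$ with inner product $(Cx\,|\,Cy)_C:=\langle Cx,y\rangle$. $J_C:\mathcal{H}_C\to F$ is the unique weakly continuous linear extension of the inclusion $\operatorname{ran}C\ni Cx\mapsto Cx\in F$. Its adjoint $J_C^*:E\to\mathcal{H}_C$,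 defined by $\langle J_C\xi,x\rangle=(\xi\,|\,J_C^*x)_C$, satisfies $J_C^*x=Cx$, so $C=J_CJ_C^*$. Since $A,B\le C=A+B$, there are (unique) positive contractions $\widetilde{A},\widetilde{B}$ on $\mathcal{H}_C$ with $A=J_C\widetilde{A}J_C^*$, $B=J_C\widetilde{B}J_C^*$; they satisfy $\widetilde{A}+\widetilde{B}=I_C$, the identity of $\mathcal{H}_C$. $B\ll A$ ($B$ is $A$-absolutely continuous) means: for every sequence $(x_n)$ in $E$, $\langle Ax_n,x_n\rangle\to0$ and $\langle B(x_n-x_m),x_n-x_m\rangle\to0$ (as $n,m\to\infty$) imply $\langle Bx_n,x_n\rangle\to0$. The operator $[A]B$ is the largest element, with respect to $\le$, of $\{D\in\mathscr{L}_+(E,F): D\le B,\ D\ll A\}$; it is known that this maximum exists and that $\langle[A]Bx,y\rangle=\lim_{n\to\infty}\langle(A:nB)x,y\rangle$ in the case of the roles reversed, i.e. in the form used here, $\langle[A]Bx,y\rangle=\lim_{n\to\infty}\langle((nA):B)x,y\rangle$ for all $x,y\in E$. *)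

(* Defs.v *)
From HB Require Import structures.
From mathcomp Require Import all_boot all_order all_algebra.
From mathcomp Require Import complex.
From mathcomp Require Import all_classical all_reals all_analysis.

Set Implicit Arguments.
Unset Strict Implicit.
Unset Printing Implicit Defensive.

Import Order.TTheory GRing.Theory Num.Theory numFieldNormedType.Exports.
Local Open Scope classical_set_scope.
Local Open Scope ring_scope.

(* The scalar field [C] is only ever instantiated by [R[i]], [R : realType].  *)
(* Its order is the partial one: [0 <= z] says that [z] is real and           *)
(* nonnegative. Operators [E -> F] are bare functions, with the pointwise     *)
(* [+], [-] and [0], and linearity is part of [positive]. Objects given by a  *)
(* definite description are written [xget 0 P]; the default [0] is returned   *)
(* only when nothing satisfies [P].                                           *)

(* linear in the first variable, conjugate-linear in the second *)
Notation "{ 'pairing' F , E 'on' C }" :=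
  {bilinear F -> E -> C | *%R & (@Num.conj C) \; *%R}
  (at level 0, F at level 99, E at level 99, C at level 99).

Section AntiDualPairs.
Context {C : numClosedFieldType} {F E : lmodType C}.
Variable pair : {pairing F, E on C}.

Definition separating : Prop :=
  (forall f g : F, (forall x : E, pair f x = pair g x) -> f = g) /\
  (forall x y : E, (forall f : F, pair f x = pair f y) -> x = y).

Definition wstar_seq_complete : Prop :=
  forall f : nat -> F,
    (forall x : E, cauchy (pair (f n) x @[n --> \oo])) ->
    exists g : F, forall x : E, pair (f n) x @[n --> \oo] --> pair g x.

(* the coarsest topology on F making all f |-> pair f x continuous *)
Definition weak_space : topologicalType :=
  initial_topology (fun f : F => pair f : prod_topology (fun _ : E => C)).

Definition positive (A : E -> F) : Prop :=
  linear A /\ forall x : E, 0 <= pair (A x) x.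

Definition le_op (S T : E -> F) : Prop :=
  forall x : E, pair (S x) x <= pair (T x) x.

Definition is_parallel_sum (A B S : E -> F) : Prop :=
  positive S /\
  forall x : E,
    infimums [set pair (A (x - y)) (x - y) + pair (B y) y | y in [set: E]]
             (pair (S x) x).

Definition parallel_sum (A B : E -> F) : E -> F :=
  xget 0 [set S | is_parallel_sum A B S].

Definition is_strong_limit (T : nat -> E -> F) (S : E -> F) : Prop :=
  positive S /\
  forall x y : E, pair (T n x) y @[n --> \oo] --> pair (S x) y.

Definition strong_limit (T : nat -> E -> F) : E -> F :=
  xget 0 [set S | is_strong_limit T S].

Fixpoint residual_seq (A B : E -> F) (n : nat) : E -> F :=
  if n is m.+1
  then residual_seq A B m - parallel_sum (residual_seq A B m) A
  else B.

Definition abs_continuous (B A : E -> F) : Prop :=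
  forall x : nat -> E,
    pair (A (x n)) (x n) @[n --> \oo] --> (0 : C) ->
    pair (B (x nm.1 - x nm.2)) (x nm.1 - x nm.2) @[nm --> (\oo, \oo)]
      --> (0 : C) ->
    pair (B (x n)) (x n) @[n --> \oo] --> (0 : C).

Definition ac_minorant (A B D : E -> F) : Prop :=
  [/\ positive D, le_op D B & abs_continuous D A].

Definition is_ac_part (A B D : E -> F) : Prop :=
  ac_minorant A B D /\ forall D', ac_minorant A B D' -> le_op D' D.

Definition ac_part (A B : E -> F) : E -> F :=
  xget 0 [set D | is_ac_part A B D].

End AntiDualPairs.

Section HilbertSpaces.
Context {C : numClosedFieldType} {H : completeNormedModType C}.
Variable dot : {dot H for (@Num.conj C)}.

(* the norm of the Banach space H is the one induced by the inner product *)
Definition hilbertian : Prop := forall xi : H, `|xi| ^+ 2 = dot xi xi.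

Definition positive_contraction (T : H -> H) : Prop :=
  [/\ linear T, forall xi : H, 0 <= dot (T xi) xi
    & forall xi : H, `|T xi| <= `|xi|].

Definition orth_proj (M : set H) (xi : H) : H :=
  xget 0 [set eta | M eta /\
                    forall zeta : H, M zeta -> dot (xi - eta) zeta = 0].

End HilbertSpaces.

Section EnergySpace.
Context {C : numClosedFieldType} {F E : lmodType C}.
Variable pair : {pairing F, E on C}.
Context {H : completeNormedModType C}.
Variable dot : {dot H for (@Num.conj C)}.

(* [H] together with the restriction of [iota] to [range T] is the Hilbert    *)
(* space completion of [range T] for the inner product (Tx | Ty) = <Tx, y>;   *)
(* the values of [iota] outside [range T] are irrelevant.                     *)
Definition is_completion (T : E -> F) (iota : F -> H) : Prop :=
  [/\ forall (a : C) (f g : F), range T f -> range T g ->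
        iota (a *: f + g) = a *: iota f + iota g,
      forall x y : E, dot (iota (T x)) (iota (T y)) = pair (T x) y
    & dense (iota @` range T)].

Definition is_embedding (T : E -> F) (iota : F -> H) (J : H -> F) : Prop :=
  [/\ linear J,
      continuous (J : weak_space dot -> weak_space pair)
    & forall f : F, range T f -> J (iota f) = f].

Definition adjoint (J : H -> F) (x : E) : H :=
  xget 0 [set eta | forall xi : H, pair (J xi) x = dot xi eta].

End EnergySpace.

(* Main.v *)
Require Import Defs.
From HB Require Import structures.
From mathcomp Require Import all_boot all_order all_algebra.
From mathcomp Require Import complex.
From mathcomp Require Import all_classical all_reals all_analysis.
From mathcomp Require Import ring lra.

(** Why the theorem is true.  Since J is weakly continuous and iota has dense
    range, J^* x = iota ((A + B) x); write K for J^*, a map with dense range.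
    Density also gives At + Bt = I, so the whole problem lives on the Hilbert
    space H, where A and B become a := At and I - a.

    The residual sequence.  If 0 <= b <= I commutes with a and b + a is
    coercive, then b + a has an inverse s and, completing the square,
      (b(u - v) | u - v) + (a v | v)
        = ((b - b s b) u | u) + ((b + a)(v - s b u) | v - s b u),
    so the infimum over v in the dense range of K is the energy of b - b s b.
    Hence one step of the recursion replaces b by b s b
    ([transfer_parallel_sum]).  Coercivity of b + a survives the step: from
    c |u|^2 <= ((b + a) u | u) for all u one gets the same bound for b s b + a
    with c^2 / 4 ([residual_admissible]).  Starting with I - a, for which
    b + a = I, this produces a decreasing sequence b_n with
    B_n = J b_n J^*.

    The limit.  A decreasing sequence of operators between 0 and I converges
    strongly.  The decrements p_n = b_n - b_{n+1} tend strongly to 0, and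
    a b_n = (b_n + a) p_n, so the limit maps into ker a; as every b_n fixes
    ker a and is self-adjoint, u - lim b_n u is orthogonal to ker a.  The limit
    is therefore the orthogonal projection P onto ker a, whose existence comes
    out of the argument, and B_s = J P J^* ([resid_seq_cvg],
    [transfer_strong_limit]).

    Absolute continuity of B - B_s.  Each B - B_n is at most n A, being a sum of
    n parallel sums with A, and these operators increase to B - B_s.  If
    <A x_n, x_n> -> 0 and (x_n) is Cauchy for B - B_s, let m go to infinity in
      q(x_n) <= 2 q(x_n - x_m) + 2 q(x_m),   q the energy of B - B_k,
    and then k ([transfer_ac_minorant]).

    Maximality.  Let D <= B be A-absolutely continuous and choose y_n with
    K y_n -> P K x.  Then <A y_n, y_n> -> 0 because a P = 0, and (y_n) is Cauchy
    for D because D <= B; so <D y_n, y_n> -> 0 and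
      <D x, x> = lim <D (x - y_n), x - y_n> <= lim <B (x - y_n), x - y_n>
               = ((I - a)(u - P u) | u - P u) = ((I - a - P) u | u),  u = K x
    ([transfer_ac_maximal]). *)

Import Order.TTheory GRing.Theory Num.Theory numFieldNormedType.Exports.
Local Open Scope classical_set_scope.
Local Open Scope ring_scope.
Local Open Scope complex_scope.

Local Notation Re := complex.Re.
Local Notation Im := complex.Im.

(** * Linear maps, complex scalars and real parts of pairings *)

Section LinearMaps.
Context {K : nzRingType} {U V : lmodType K} {f : U -> V} (f_lin : linear f).

Lemma linearD_fun u v : f (u + v) = f u + f v.
Proof. by have := f_lin 1 u v; rewrite !scale1r. Qed.

Lemma linear0_fun : f 0 = 0.
Proof. by apply: (addrI (f 0)); rewrite -linearD_fun !addr0. Qed.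

Lemma linearZ_fun a u : f (a *: u) = a *: f u.
Proof. by have := f_lin a u 0; rewrite !addr0 linear0_fun addr0. Qed.

Lemma linearB_fun u v : f (u - v) = f u - f v.
Proof. by rewrite linearD_fun -scaleN1r linearZ_fun scaleN1r. Qed.

End LinearMaps.

Section Scalars.
Context {R : realType}.
Implicit Types z : R[i].

Lemma ReD z1 z2 : Re (z1 + z2) = Re z1 + Re z2.
Proof. by case: z1; case: z2. Qed.
Lemma ReN z1 : Re (- z1) = - Re z1.
Proof. by case: z1. Qed.
Lemma ReB z1 z2 : Re (z1 - z2) = Re z1 - Re z2.
Proof. by rewrite ReD ReN. Qed.
Lemma ReM t z : Re (t%:C * z) = t * Re z.
Proof. by case: z => a b /=; rewrite mul0r subr0. Qed.
Lemma conj_complex z : z^*%R = z^*%C.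
Proof. by []. Qed.

Lemma ge0cP z : 0 <= z <-> Im z = 0 /\ 0 <= Re z.
Proof. by rewrite lecE /=; split=> [/andP[/eqP]|[-> ->]]; rewrite ?eqxx. Qed.

End Scalars.

Section RealPairing.
Context {R : realType} {F E : lmodType R[i]} (pair : {pairing F, E on R[i]}).

(** Only real parts are needed for estimates, and they put the inequalities in
    the ordered field R, out of the partially ordered complex field. *)
Definition rpair (f : F) (x : E) : R := Re (pair f x).

Lemma rpairDl f g x : rpair (f + g) x = rpair f x + rpair g x.
Proof. by rewrite /rpair linearDl ReD. Qed.
Lemma rpairBl f g x : rpair (f - g) x = rpair f x - rpair g x.
Proof. by rewrite /rpair linearBl ReB. Qed.
Lemma rpairDr f x y : rpair f (x + y) = rpair f x + rpair f y.
Proof. by rewrite /rpair linearDr ReD. Qed.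
Lemma rpairBr f x y : rpair f (x - y) = rpair f x - rpair f y.
Proof. by rewrite /rpair linearBr ReB. Qed.
Lemma rpairZl t f x : rpair (t%:C *: f) x = t * rpair f x.
Proof. by rewrite /rpair linearZl_LR ReM. Qed.
Lemma rpairZr t f x : rpair f (t%:C *: x) = t * rpair f x.
Proof. by rewrite /rpair linearZr_LR /= conj_complex conjc_real ReM. Qed.

End RealPairing.

(** * Positive operators and their energies *)

Section PositiveOperators.
Context {R : realType} {F E : lmodType R[i]} (pair : {pairing F, E on R[i]}).
Local Notation rp := (rpair pair).

(** Over the complex numbers the diagonal of a sesquilinear form determines the
    form: compare the values at u + v and at iu + v. *)
Lemma polarization (f : E -> E -> R[i]) :
  (forall a u v w, f (a *: u + v) w = a * f u w + f v w) ->
  (forall a u v w, f w (a *: u + v) = a^*%C * f w u + f w v) ->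
  (forall u, f u u = 0) -> forall u v, f u v = 0.
Proof.
move=> fl fr f0 u v.
have f0v w : f 0 w = 0.
  by have := fl (-1) w w w; rewrite scaleN1r addNr mulN1r addNr.
have fv0 w : f w 0 = 0.
  by have := fr (-1) w w w; rewrite scaleN1r addNr rmorphN1 mulN1r addNr.
have H1 : f u v + f v u = 0.
  have := f0 (1 *: u + v).
  by rewrite fl !fr !f0 conjc1 !mul1r add0r addr0.
have H2 : f u v - f v u = 0.
  have := f0 ('i *: u + v).
  rewrite fl !fr !f0 mulr0 add0r addr0 => Hi.
  have ci : ('i : R[i])^*%C = - 'i.
    by apply/eqP; rewrite eq_complex /= oppr0 !eqxx.
  move: Hi; rewrite ci mulNr -mulrBr => /eqP; rewrite mulf_eq0 => /orP[|/eqP //].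
  by rewrite eq_complex /= oner_eq0 andbF.
have : f u v *+ 2 = 0 by rewrite mulr2n -[RHS]addr0 -{1}H1 -{1}H2; ring.
by move=> /eqP; rewrite mulrn_eq0 /= => /eqP.
Qed.

(** This is why parallel sums and absolutely continuous parts, which are
    characterized by their energies alone, are unique as operators. *)
Lemma linear_eq_quad (S T : E -> F) :
  (forall f g, (forall x, pair f x = pair g x) -> f = g) ->
  linear S -> linear T -> (forall x, pair (S x) x = pair (T x) x) -> S = T.
Proof.
move=> sep Sl Tl ST; apply/funext => x; apply: sep => y.
apply/eqP; rewrite -subr_eq0; apply/eqP.
apply: (polarization (fun x y => pair (S x) y - pair (T x) y))
  => [a u v w|a u v w|u].
- by rewrite Sl Tl !linearPl; ring.
- by rewrite !linearPr /= !conj_complex; ring.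
- by rewrite ST subrr.
Qed.

Context (T : E -> F) (T_pos : positive pair T).

Lemma positive_herm x y : pair (T x) y = (pair (T y) x)^*%C.
Proof.
apply/eqP; rewrite -subr_eq0; apply/eqP; case: T_pos => Tl Tp.
apply: (polarization (fun x y => pair (T x) y - (pair (T y) x)^*%C))
  => [a u v w|a u v w|u].
- rewrite Tl linearPl linearPr /= !conj_complex rmorphD rmorphM /= conjcK; ring.
- rewrite Tl linearPl linearPr /= !conj_complex rmorphD rmorphM /=; ring.
- have /ge0cP[im0 _] := Tp u.
  by move: im0; case: (pair _ _) => a b /= ->; rewrite oppr0 subrr.
Qed.

Lemma positive_rsym x y : rp (T x) y = rp (T y) x.
Proof. by rewrite /rpair positive_herm; case: (pair _ _). Qed.

Lemma positive_quad_ge0 x : 0 <= rp (T x) x.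
Proof. by case: T_pos => _ /(_ x) /ge0cP[]. Qed.

Lemma positive_quadE x : pair (T x) x = (rp (T x) x)%:C.
Proof.
by case: T_pos => _ /(_ x) /ge0cP[]; rewrite /rpair; case: (pair _ _) => a b /= ->.
Qed.

Lemma quadD x y : rp (T (x + y)) (x + y) = rp (T x) x + rp (T y) y + 2 * rp (T x) y.
Proof.
case: T_pos => Tl _.
by rewrite (linearD_fun Tl) rpairDl !rpairDr (positive_rsym y x); lra.
Qed.

Lemma quadB x y : rp (T (x - y)) (x - y) = rp (T x) x + rp (T y) y - 2 * rp (T x) y.
Proof.
case: T_pos => Tl _.
by rewrite (linearB_fun Tl) rpairBl !rpairBr (positive_rsym y x); lra.
Qed.

(** Scaled arithmetic-geometric form of the Cauchy-Schwarz inequality: the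
    energy of ex - y is nonnegative. *)
Lemma quad_bilinear_le (e : R) x y : 0 < e ->
  2 * rp (T x) y <= e * rp (T x) x + e^-1 * rp (T y) y.
Proof.
move=> e0; case: T_pos => Tl _.
have ee : e * e^-1 = 1 by rewrite divff ?gt_eqF.
have := positive_quad_ge0 (e%:C *: x - y).
rewrite quadB (linearZ_fun Tl) !rpairZl !rpairZr => H1.
by rewrite -(ler_pM2l e0) mulrDr (mulrA e e^-1) ee mul1r; lra.
Qed.

(** The substitute for the triangle inequality of the energy seminorm that
    avoids square roots. *)
Lemma quadD_le (e : R) x y : 0 < e ->
  rp (T (x + y)) (x + y) <= (1 + e) * rp (T x) x + (1 + e^-1) * rp (T y) y.
Proof.
move=> e0; have := quad_bilinear_le e x y e0; rewrite quadD; lra.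
Qed.

Lemma quadD_le2 x y : rp (T (x + y)) (x + y) <= 2 * rp (T x) x + 2 * rp (T y) y.
Proof. by have := quadD_le 1 x y ltr01; rewrite invr1; lra. Qed.

Lemma quadN x : rp (T (- x)) (- x) = rp (T x) x.
Proof.
case: T_pos => Tl _.
by rewrite -(sub0r x) quadB (linear0_fun Tl) /rpair !linear0l /=; lra.
Qed.

Lemma quadB_le2 x y : rp (T (x - y)) (x - y) <= 2 * rp (T x) x + 2 * rp (T y) y.
Proof. by have := quadD_le2 x (- y); rewrite quadN. Qed.

End PositiveOperators.

Section Energies.
Context {R : realType} {F E : lmodType R[i]} (pair : {pairing F, E on R[i]}).

Lemma le_opP (S T : E -> F) : positive pair S -> positive pair T ->
  le_op pair S T <-> forall x, rpair pair (S x) x <= rpair pair (T x) x.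
Proof.
by move=> Sp Tp; split=> ST x; have := ST x; rewrite !positive_quadE // lecR.
Qed.

End Energies.

Section PositiveAlgebra.
Context {R : realType} {F E : lmodType R[i]} (pair : {pairing F, E on R[i]}).

Lemma positiveD S T : positive pair S -> positive pair T -> positive pair (S + T).
Proof.
move=> [Sl S0] [Tl T0]; split=> [k x y|x].
  by rewrite /GRing.add /= Sl Tl scalerDr addrACA.
by rewrite linearDl addr_ge0 ?S0 ?T0.
Qed.

Lemma positiveB S T : positive pair S -> positive pair T ->
  (forall x, rpair pair (S x) x <= rpair pair (T x) x) -> positive pair (T - S).
Proof.
move=> Sp Tp ST; have [[Sl _] [Tl _]] := (Sp, Tp); split=> [k x y|x].
  rewrite -[LHS]/(T (k *: x + y) - S (k *: x + y)) Sl Tl opprD addrACA.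
  by rewrite -scalerBr.
rewrite -[(T - S) x]/(T x - S x) linearBl !positive_quadE //.
by rewrite -rmorphB /= ler0c subr_ge0.
Qed.
End PositiveAlgebra.

(** * Limits of real and complex sequences *)

Section RealSequences.
Context {R : realType}.

Lemma cvg0_le (f g : nat -> R) : (forall n, 0 <= f n) -> (forall n, f n <= g n) ->
  g n @[n --> \oo] --> (0 : R) -> f n @[n --> \oo] --> (0 : R).
Proof.
move=> f0 fg g0.
apply: (@squeeze_cvgr _ _ _ _ (fun=> 0) g) => //; last exact: cvg_cst.
by near=> n; rewrite f0 fg.
Unshelve. all: by end_near.
Qed.

Lemma cvg0_ge_const (a : R) (g : nat -> R) : (forall n, a <= g n) ->
  g n @[n --> \oo] --> (0 : R) -> a <= 0.
Proof.
move=> ag g0; have <- : lim (g n @[n --> \oo]) = 0 by exact/cvg_lim.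
by apply: limr_ge; [apply/cvg_ex; exists 0|near=> n; exact: ag].
Unshelve. all: by end_near.
Qed.

Lemma cvg0Zl (k : R) (g : nat -> R) :
  g n @[n --> \oo] --> (0 : R) -> k * g n @[n --> \oo] --> (0 : R).
Proof. by move=> g0; rewrite -(mulr0 k); apply: cvgMr. Qed.

Lemma cvg0D (f g : nat -> R) : f n @[n --> \oo] --> (0 : R) ->
  g n @[n --> \oo] --> (0 : R) -> f n + g n @[n --> \oo] --> (0 : R).
Proof. by move=> f0 g0; rewrite -(addr0 0); apply: cvgD. Qed.

Lemma cvg0_sqr (x g : nat -> R) : (forall n, x n ^+ 2 <= g n) ->
  g n @[n --> \oo] --> (0 : R) -> x n @[n --> \oo] --> (0 : R).
Proof.
move=> xg g0; apply/cvgrPdist_lt => e e0.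
have [N _ gN] := cvgr_lt _ g0 _ (exprn_gt0 2 e0).
exists N => // n /gN gn.
rewrite sub0r normrN -(@ltr_pXn2r _ 2) ?nnegrE ?normr_ge0 ?ltW //.
by rewrite real_normK ?num_real //; apply: le_lt_trans gn.
Qed.

End RealSequences.

Section ComplexLimits.
Context {R : realType}.
Local Notation C := (R[i] : numClosedFieldType).

Lemma normc_real (r : R) : `|r%:C| = `|r|%:C :> R[i].
Proof. by rewrite normc_def /= expr0n addr0 sqrtr_sqr. Qed.

Lemma cvg_real_complex {I : Type} {F : set_system I} {FF : Filter F} (r : I -> R) :
  ((r i)%:C : C) @[i --> F] --> (0 : C) <-> r i @[i --> F] --> (0 : R).
Proof.
split=> /cvgrPdist_lt r0; apply/cvgrPdist_lt => e e0.
  have e0' : 0 < e%:C by rewrite ltcR.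
  apply: filterS (r0 _ e0') => i.
  by rewrite !sub0r !normrN normc_real ltcR.
have [er0 eE] : 0 < Re e /\ e = (Re e)%:C.
  by move: e0; rewrite ltcE /= => /andP[/eqP]; case: e => x y /= ->.
apply: filterS (r0 _ er0) => i.
by rewrite eE !sub0r !normrN normc_real ltcR.
Qed.

Lemma cvg_complex_parts {I : Type} {F : set_system I} {FF : Filter F}
    (z : I -> C) (l : C) :
  Re (z i - l) @[i --> F] --> (0 : R) -> Im (z i - l) @[i --> F] --> (0 : R) ->
  z i @[i --> F] --> l.
Proof.
move=> /cvg_real_complex z1 /cvg_real_complex z2.
have := cvgD z1 (cvgMr (a := 'i%C : C) z2); rewrite mulr0 addr0 => h.
have zE : z - cst l
    = (fun i => (Re (z i - l))%:C + ('i%C : C) * (Im (z i - l))%:C).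
  by apply/funext => i; rewrite [LHS]complexE.
apply: cvg_zero.
rewrite zE.
exact: h.
Qed.

End ComplexLimits.

(** * Hilbert spaces through the squared norm *)

Section HilbertSpace.
Context {R : realType} {H : completeNormedModType R[i]}.
Context (dot : {dot H for (@Num.conj R[i])}) (dot_norm : hilbertian dot).
Local Notation ip := (rpair dot).

Definition sqnorm (u : H) : R := ip u u.
Local Notation sq := sqnorm.

Lemma positive_id : positive dot id.
Proof. by split=> // u; exact: dnorm_ge0. Qed.

Lemma ipC u v : ip u v = ip v u.
Proof. exact: (positive_rsym dot id positive_id). Qed.

Lemma sqnorm_ge0 u : 0 <= sq u.
Proof. exact: (positive_quad_ge0 dot id positive_id). Qed.

Lemma dot_sqnorm u : dot u u = (sq u)%:C.
Proof. exact: (positive_quadE dot id positive_id). Qed.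

Lemma sqnorm_eq0 u : sq u = 0 -> u = 0.
Proof. by move=> u0; apply/eqP; rewrite -(dnorm_eq0 dot) dot_sqnorm u0. Qed.

Lemma sqnorm0 : sq 0 = 0.
Proof. by rewrite /sq /rpair linear0l. Qed.

Lemma sqnormB u v : sq (u - v) = sq u + sq v - 2 * ip u v.
Proof. exact: (quadB dot id positive_id). Qed.

Lemma sqnormN u : sq (- u) = sq u.
Proof. exact: (quadN dot id positive_id). Qed.

Lemma sqnormD_le2 u v : sq (u + v) <= 2 * sq u + 2 * sq v.
Proof. exact: (quadD_le2 dot id positive_id). Qed.

Lemma sqnormB_le2 u v : sq (u - v) <= 2 * sq u + 2 * sq v.
Proof. exact: (quadB_le2 dot id positive_id). Qed.

Lemma sqnormZ (t : R) u : sq (t%:C *: u) = t ^+ 2 * sq u.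
Proof. by rewrite /sq rpairZl rpairZr; ring. Qed.

(** The bridge between the complex-valued norm, which carries the topology, and
    the real-valued squared norm, which carries the estimates. *)
Lemma norm_lt_sqnorm (e : R) u : 0 < e -> (`|u| < e%:C) = (sq u < e ^+ 2).
Proof.
move=> e0; have ec : 0 < e%:C by rewrite ltcR.
rewrite -(@ltr_pXn2r _ 2) ?nnegrE ?normr_ge0 ?ltW //.
by rewrite dot_norm dot_sqnorm -rmorphXn ltcR.
Qed.

(** Norm convergence, expressed with real numbers instead of the norm of H,
    whose values are complex numbers. *)
Definition hcvg (u : nat -> H) (l : H) := sq (u n - l) @[n --> \oo] --> (0 : R).

Lemma sqnorm_dense (D : set H) : dense D ->
  forall u (e : R), 0 < e -> exists2 d, D d & sq (u - d) < e.
Proof.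
move=> Dd u e e0; have s0 : 0 < Num.sqrt e by rewrite sqrtr_gt0.
have sc : 0 < (Num.sqrt e)%:C by rewrite ltcR.
have [|d [/interior_subset ud Dd']] :=
    Dd _ _ (open_interior (ball u (Num.sqrt e)%:C)).
  by exists u; exact: nbhsx_ballx.
exists d => //.
by move: ud; rewrite -ball_normE /ball_ /= norm_lt_sqnorm // sqr_sqrtr // ltW.
Qed.

Lemma hcvg_complete (u : nat -> H) (d : nat -> R) :
  (forall n m, (n <= m)%N -> sq (u n - u m) <= d n) ->
  d n @[n --> \oo] --> (0 : R) -> exists l, hcvg u l.
Proof.
move=> ud d0; have dlt (e : R) : 0 < e -> exists N, forall n, (N <= n)%N -> d n < e.
  move=> e0; have [N _ dN] := cvgr_lt _ d0 _ e0.
  by exists N => n Nn; exact: dN.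
have /cvg_ex[l ul] : cvg (u n @[n --> \oo]).
  apply/cauchy_cvgP/cauchy_ballP => e e0.
  have [er0 eE] : 0 < Re e /\ e = (Re e)%:C.
    by move: e0; rewrite ltcE /= => /andP[/eqP]; case: e => x y /= ->.
  have [N dN] := dlt (Re e ^+ 2) (exprn_gt0 _ er0).
  exists (u @` [set n | (N <= n)%N], u @` [set n | (N <= n)%N]).
    by split; exists N => // n Nn; exists n.
  move=> [_ _] /= [[n /= Nn <-] [m /= Nm <-]].
  rewrite eE -ball_normE /ball_ /= norm_lt_sqnorm //.
  have [nm|mn] := leP n m; first exact: le_lt_trans (ud _ _ nm) (dN _ Nn).
  rewrite -sqnormN opprB; exact: le_lt_trans (ud _ _ (ltnW mn)) (dN _ Nm).
exists l; apply/cvgrPdist_lt => e e0.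
have s0 : 0 < (Num.sqrt e)%:C by rewrite ltcR sqrtr_gt0.
move/cvgrPdist_lt: ul => /(_ _ s0); apply: filterS => n.
rewrite norm_lt_sqnorm ?sqrtr_gt0 // sqr_sqrtr ?(ltW e0) // -sqnormN opprB.
by rewrite sub0r normrN ger0_norm // sqnorm_ge0.
Qed.

End HilbertSpace.

(** * Inverting coercive operators *)

Section HilbertOperators.
Context {R : realType} {H : completeNormedModType R[i]}.
Context (dot : {dot H for (@Num.conj R[i])}) (dot_norm : hilbertian dot).
Local Notation ip := (rpair dot).
Local Notation sq := (sqnorm dot).

(** If 0 <= T <= M then T^2 <= M T: expand the energy of Mu - Tu. *)
Lemma positive_sqnorm_le (M : R) T u : positive dot T -> 0 < M ->
  (forall v, ip (T v) v <= M * sq v) -> sq (T u) <= M * ip (T u) u.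
Proof.
move=> Tp M0 TM; have [Tl _] := Tp.
have := positive_quad_ge0 dot T Tp (M%:C *: u - T u).
rewrite (quadB dot T Tp) (linearZ_fun Tl) !rpairZl !rpairZr.
have := TM (T u); rewrite -/(sq (T u)) => H1 H2.
rewrite -subr_ge0 -(pmulr_rge0 _ M0); lra.
Qed.

Section Coercive.
Context (T : H -> H) (T_pos : positive dot T) (c M : R).
Hypotheses (c_gt0 : 0 < c) (c_le : c <= M).
Hypotheses (T_ge : forall u, c * sq u <= ip (T u) u)
           (T_le : forall u, ip (T u) u <= M * sq u).

Let M_gt0 : 0 < M. Proof. exact: lt_le_trans c_le. Qed.
Let T_lin : linear T. Proof. by case: T_pos. Qed.

(** Expand |Tu - cu|^2 >= 0. *)
Lemma coercive_sqnorm_ge u : c ^+ 2 * sq u <= sq (T u).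
Proof.
have := sqnorm_ge0 dot (T u - c%:C *: u).
rewrite sqnormB sqnormZ rpairZr => H1.
have := ler_wpM2l (ltW c_gt0) (T_ge u); lra.
Qed.

Lemma coercive_inj u v : T u = T v -> u = v.
Proof.
move=> uv; apply/eqP; rewrite -subr_eq0; apply/eqP/(sqnorm_eq0 dot).
apply: le_anti; rewrite sqnorm_ge0 andbT.
have := coercive_sqnorm_ge (u - v).
by rewrite (linearB_fun T_lin) uv subrr sqnorm0 pmulr_rle0 ?exprn_gt0.
Qed.

(** Richardson iteration for the equation T z = y. *)
Fixpoint richardson (y : H) (n : nat) : H :=
  if n is k.+1
  then richardson y k + (M^-1)%:C *: (y - T (richardson y k))
  else 0.

Let q := 1 - c / M.

(** The residual y - T z is multiplied at each step by I - T/M, whose squared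
    norm is at most 1 - c/M because T^2 <= M T. *)
Lemma richardson_residual y n : sq (y - T (richardson y n)) <= q ^+ n * sq y.
Proof.
elim: n => [|n IH] /=; first by rewrite (linear0_fun T_lin) subr0 mul1r.
set r := y - T _ in IH *.
have -> : y - T (richardson y n + (M^-1)%:C *: r) = r - (M^-1)%:C *: T r.
  by rewrite (linearD_fun T_lin) (linearZ_fun T_lin) opprD addrA.
rewrite sqnormB sqnormZ rpairZr (ipC dot r).
have Mi : 0 < M^-1 by rewrite invr_gt0.
have MM : M^-1 * M = 1 by rewrite mulVf ?gt_eqF.
have H1 : M^-1 ^+ 2 * sq (T r) <= M^-1 * ip (T r) r.
  have := ler_wpM2l (ltW Mi) (positive_sqnorm_le M T r T_pos M_gt0 T_le).
  rewrite mulrA MM mul1r => H1; have := ler_wpM2l (ltW Mi) H1.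
  by rewrite mulrA -expr2.
have H2 := ler_wpM2l (ltW Mi) (T_ge r).
apply: (@le_trans _ _ (q * sq r)); first by rewrite /q; lra.
rewrite exprS -mulrA; apply: ler_wpM2l => //.
by rewrite /q subr_ge0 ler_pdivrMr // mul1r.
Qed.

Let qX_cvg : q ^+ n @[n --> \oo] --> (0 : R).
Proof.
apply: cvg_expr; rewrite ger0_norm /q.
  by rewrite ltrBlDr ltrDl divr_gt0.
by rewrite subr_ge0 ler_pdivrMr // mul1r.
Qed.

(** The differences of iterates are controlled through T by coercivity, so the
    decay of the residuals makes the iterates a Cauchy sequence. *)
Lemma coercive_surj y : exists z, T z = y.
Proof.
have q0 : 0 <= q by rewrite /q subr_ge0 ler_pdivrMr // mul1r.
have q1 : q <= 1 by rewrite /q lerBlDr lerDl divr_ge0 // ltW.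
have ci2 : 0 < c ^- 2 by rewrite invr_gt0 exprn_gt0.
have cc : c ^- 2 * c ^+ 2 = 1 by rewrite mulVf ?gt_eqF ?exprn_gt0.
have [|z zl] := @hcvg_complete _ _ dot dot_norm (richardson y)
    (fun n => c ^- 2 * (4 * sq y) * q ^+ n) _ (cvg0Zl _ _ qX_cvg).
  move=> n m nm; set d := _ - _.
  have H1 : sq (T d) <= 4 * sq y * q ^+ n.
    have -> : T d = (y - T (richardson y m)) - (y - T (richardson y n)).
      by rewrite /d (linearB_fun T_lin) opprB [RHS]addrC addrA subrK.
    have := richardson_residual y n; have := richardson_residual y m.
    have := sqnormB_le2 dot (y - T (richardson y m)) (y - T (richardson y n)).
    have : q ^+ m * sq y <= q ^+ n * sq y.
      by apply: ler_wpM2r; rewrite ?sqnorm_ge0 // ler_wiXn2l.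
    lra.
  have := ler_wpM2l (ltW ci2) (le_trans (coercive_sqnorm_ge d) H1).
  by rewrite mulrA cc mul1r !mulrA.
exists z; apply/eqP; rewrite -subr_eq0; apply/eqP/(sqnorm_eq0 dot).
apply: le_anti; rewrite sqnorm_ge0 andbT.
apply: (@cvg0_ge_const _ _ (fun n => (2 * M ^+ 2) * sq (richardson y n - z)
         + (2 * sq y) * q ^+ n)); last first.
  by apply: cvg0D; apply: cvg0Zl.
move=> n; set zn := richardson y n.
have -> : T z - y = - (T (zn - z) + (y - T zn)).
  by rewrite (linearB_fun T_lin) (addrC (T zn - T z)) addrA subrK opprB.
rewrite sqnormN.
have := sqnormD_le2 dot (T (zn - z)) (y - T zn).
have := richardson_residual y n; rewrite -/zn => H1 H2.
have := positive_sqnorm_le M T (zn - z) T_pos M_gt0 T_le.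
have := ler_wpM2l (ltW M_gt0) (T_le (zn - z)); lra.
Qed.

End Coercive.
End HilbertOperators.

(** * Operators between zero and the identity *)

Section Effects.
Context {R : realType} {H : completeNormedModType R[i]}.
Context (dot : {dot H for (@Num.conj R[i])}) (dot_norm : hilbertian dot).
Local Notation ip := (rpair dot).
Local Notation sq := (sqnorm dot).

Definition effect (T : H -> H) : Prop :=
  positive dot T /\ forall u, ip (T u) u <= sq u.

Lemma effect_sqnorm_le T u : effect T -> sq (T u) <= ip (T u) u.
Proof.
move=> [Tp Tle]; rewrite -[leRHS]mul1r.
by apply: positive_sqnorm_le => // v; rewrite mul1r.
Qed.

Lemma effectB S T : effect S -> effect T ->
  (forall u, ip (S u) u <= ip (T u) u) -> effect (T - S).
Proof.
move=> [Sp _] [Tp Tle] ST; split; first exact: positiveB.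
move=> u; rewrite -[(T - S) u]/(T u - S u) rpairBl.
by have := positive_quad_ge0 dot S Sp u; have := Tle u; lra.
Qed.

(** For n <= m the difference S = T n - T m lies between 0 and the identity, so
    |S u|^2 <= (S u | u), and the energies form a convergent real sequence. *)
Lemma effect_decreasing_cvg (T : nat -> H -> H) : (forall n, effect (T n)) ->
  (forall n u, ip (T n.+1 u) u <= ip (T n u) u) ->
  forall u, exists l, hcvg dot (T^~ u) l.
Proof.
move=> Te Tdec u; set x := fun n => ip (T n u) u.
have xdec : nonincreasing_seq x by apply/nonincreasing_seqP => n; exact: Tdec.
have xlb : has_lbound (range x).
  by exists 0 => _ [n _ <-]; have [Tp _] := Te n; exact: positive_quad_ge0.
have xcvg := nonincreasing_cvgn xdec xlb.
apply: (@hcvg_complete _ _ dot dot_norm _ (fun n => x n - inf (range x))).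
  move=> n m nm; have /(effect_sqnorm_le _ u) : effect (T n - T m).
    apply: effectB => // v.
    have vdec : nonincreasing_seq (fun n => ip (T n v) v).
      by apply/nonincreasing_seqP => k; exact: Tdec.
    exact: vdec.
  rewrite -[(T n - T m) u]/(T n u - T m u) rpairBl -/(x n) -/(x m).
  have : inf (range x) <= x m by apply: ge_inf => //; exists m.
  lra.
by rewrite -(subrr (inf (range x))); apply: cvgB => //; exact: cvg_cst.
Qed.

End Effects.

(** * One step of the residual sequence *)

Section Shorting.
Context {R : realType} {H : completeNormedModType R[i]}.
Context (dot : {dot H for (@Num.conj R[i])}) (dot_norm : hilbertian dot).
Local Notation ip := (rpair dot).
Local Notation sq := (sqnorm dot).

Definition opinv (T : H -> H) (y : H) : H := xget 0 [set z | T z = y].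

Context (a : H -> H) (a_eff : effect dot a).

(** The operator b (b + a)^-1 b, that is, b minus the parallel sum of b and a. *)
Definition residual (b : H -> H) (u : H) : H := b (opinv (b + a) (b u)).

(** What the recursion preserves.  Coercivity of b + a makes the next step
    defined; commutation and the action on ker a identify the limit. *)
Record admissible (b : H -> H) : Prop := Admissible {
  adm_effect : effect dot b;
  adm_comm : forall u, b (a u) = a (b u);
  adm_fix : forall u, a u = 0 -> b u = u;
  adm_coercive : exists c : R, [/\ 0 < c, c <= 1 &
    forall u, c * sq u <= ip (b u + a u) u]
}.

Let a_lin : linear a. Proof. by case: a_eff => [[]]. Qed.
Let a_pos : positive dot a. Proof. by case: a_eff. Qed.

Section Step.
Context (b : H -> H) (b_adm : admissible b).
Local Notation T := (b + a).
Local Notation s := (opinv T).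

Let b_eff := adm_effect b b_adm.
Let b_pos : positive dot b. Proof. by case: b_eff. Qed.
Let b_lin : linear b. Proof. by case: b_pos. Qed.
Let T_pos : positive dot T. Proof. exact: positiveD. Qed.
Let T_lin : linear T. Proof. by case: T_pos. Qed.

Let T_le u : ip (T u) u <= 2 * sq u.
Proof.
rewrite -[T u]/(b u + a u) rpairDl.
by have [[_ H1] [_ H2]] := (a_eff, b_eff); have := H1 u; have := H2 u; lra.
Qed.

Let T_inj u v : T u = T v -> u = v.
Proof.
have [c [c0 c1 Tc]] := adm_coercive b b_adm.
exact: (coercive_inj dot T T_pos c c0 Tc).
Qed.

Lemma opinvK y : T (s y) = y.
Proof.
have [c [c0 c1 Tc]] := adm_coercive b b_adm.
have c2 : c <= 2 by apply: le_trans c1 _; rewrite ler1n.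
have [z zy] := coercive_surj dot dot_norm T T_pos c 2 c0 c2 Tc T_le y.
exact: (@xgetPex _ 0 [set z | T z = y] (ex_intro _ z zy)).
Qed.

Lemma opinv_eq z y : T z = y -> s y = z.
Proof. by move=> zy; apply: T_inj; rewrite opinvK. Qed.

Let s_lin : linear s.
Proof. by move=> k u v; apply: opinv_eq; rewrite T_lin !opinvK. Qed.

Let aT u : T (a u) = a (T u).
Proof. by rewrite /GRing.add /= (adm_comm b b_adm) (linearD_fun a_lin). Qed.

Let bT u : T (b u) = b (T u).
Proof. by rewrite /GRing.add /= (linearD_fun b_lin) (adm_comm b b_adm). Qed.

Lemma residual_quad u : ip (residual b u) u = ip (T (s (b u))) (s (b u)).
Proof. by rewrite /residual (positive_rsym dot b b_pos) opinvK. Qed.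

Lemma residual_positive : positive dot (residual b).
Proof.
split=> [k u v|u]; first by rewrite /residual b_lin s_lin b_lin.
rewrite /residual (positive_herm dot b b_pos) -{1}(opinvK (b u)).
by rewrite (positive_quadE dot _ T_pos) conjc_real ler0c positive_quad_ge0.
Qed.

(** Completing the square in v: the minimum over v is attained at
    v = (b + a)^-1 b u, and its value is the energy of b - b (b + a)^-1 b. *)
Lemma decrement_energy u v :
  ip (b (u - v)) (u - v) + ip (a v) v =
  ip (b u - residual b u) u + ip (T (v - s (b u))) (v - s (b u)).
Proof.
rewrite rpairBl residual_quad (quadB dot b b_pos) (quadB dot T T_pos).
rewrite (positive_rsym dot T T_pos v (s (b u))) !opinvK.
by rewrite -[T v]/(b v + a v) rpairDl; lra.
Qed.

Lemma residual_le u : ip (residual b u) u <= ip (b u) u.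
Proof.
have := decrement_energy u (s (b u)).
rewrite subrr /rpair linear0r /= addr0 -/(rpair dot _ _) => H1.
have := positive_quad_ge0 dot b b_pos (u - s (b u)).
have := positive_quad_ge0 dot a a_pos (s (b u)).
by move: H1; rewrite -/(rpair dot _ _) -/(ip _ _) rpairBl /rpair; lra.
Qed.

Lemma residual_effect : effect dot (residual b).
Proof.
split; first exact: residual_positive.
by move=> u; apply: le_trans (residual_le u) _; case: b_eff.
Qed.

Lemma decrement_effect : effect dot (b - residual b).
Proof. by apply: effectB; [exact: residual_effect| |exact: residual_le]. Qed.

Lemma decrementE u : b u - residual b u = b (s (a u)).
Proof.
rewrite /residual -(linearB_fun b_lin); congr (b _).
rewrite -{1}(opinv_eq u (T u) erefl) -(linearB_fun s_lin); congr (s _).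
by rewrite -[T u]/(b u + a u) addrAC subrr add0r.
Qed.

(** As b commutes with a, b - residual b = b (b + a)^-1 a, and b + a cancels its
    inverse.  In the limit this shows that the residuals map into ker a. *)
Lemma decrement_comm u : T (b u - residual b u) = a (b u).
Proof. by rewrite decrementE bT opinvK (adm_comm b b_adm). Qed.

(** For the coercivity constant, let s be the inverse of b + a.  Since
    b + a <= 2, (b s b u | u) >= |b u|^2 / 2, while (a u | u) >= |a u|^2; together
    they dominate |b u + a u|^2 / 4 >= c^2 |u|^2 / 4. *)
Lemma residual_admissible : admissible (residual b).
Proof.
have sa u : s (a u) = a (s u) by apply: opinv_eq; rewrite aT opinvK.
split.
- exact: residual_effect.
- by move=> u; rewrite /residual (adm_comm b b_adm) sa (adm_comm b b_adm).
- move=> u au; have bu := adm_fix b b_adm u au.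
  rewrite /residual bu (opinv_eq u) // -[T u]/(b u + a u).
  by rewrite bu au addr0.
- have [c [c0 c1 Tc]] := adm_coercive b b_adm.
  exists (c ^+ 2 / 4); split.
  + by rewrite divr_gt0 ?exprn_gt0.
  + have : c ^+ 2 <= 1 by rewrite expr_le1 // ltW.
    lra.
  + move=> u; rewrite rpairDl residual_quad.
    have := coercive_sqnorm_ge dot T c c0 Tc u.
    rewrite -[T u]/(b u + a u).
    have := sqnormD_le2 dot (b u) (a u).
    have := positive_sqnorm_le dot 2 T (s (b u)) T_pos (ltr0Sn R 1) T_le.
    rewrite opinvK.
    have := effect_sqnorm_le dot a u a_eff.
    have := positive_quad_ge0 dot a a_pos u.
    lra.
Qed.

End Step.
End Shorting.

(** * The residual sequence and the projection onto the kernel *)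

Section Projection.
Context {R : realType} {H : completeNormedModType R[i]}.
Context (dot : {dot H for (@Num.conj R[i])}) (dot_norm : hilbertian dot).
Local Notation ip := (rpair dot).
Local Notation sq := (sqnorm dot).

Lemma ip_sqr_le u v : ip u v ^+ 2 <= sq u * sq v.
Proof.
have [v0|v0] := eqVneq (sq v) 0.
  by rewrite (sqnorm_eq0 dot v v0) sqnorm0 /rpair linear0r expr0n mulr0.
have vgt : 0 < sq v by rewrite lt_def v0 sqnorm_ge0.
have := sqnorm_ge0 dot ((sq v)%:C *: u - (ip u v)%:C *: v).
rewrite sqnormB !sqnormZ rpairZl rpairZr => H1.
rewrite -subr_ge0 -(pmulr_rge0 _ vgt); lra.
Qed.

Lemma hcvg_ip u l v : hcvg dot u l -> ip (u n - l) v @[n --> \oo] --> (0 : R).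
Proof.
move=> ul; apply: (cvg0_sqr _ (fun n => sq v * sq (u n - l))).
  by move=> n; rewrite mulrC ip_sqr_le.
exact: cvg0Zl.
Qed.

Lemma Im_dot u v : Im (dot u v) = ip u ('i%C *: v).
Proof.
rewrite /rpair linearZr_LR /= conj_complex; case: (dot u v) => x y /=.
by rewrite mul0r sub0r mulN1r opprK.
Qed.

Lemma hcvg_dot u l v : hcvg dot u l -> dot (u n) v @[n --> \oo] --> dot l v.
Proof.
move=> ul; apply: cvg_complex_parts.
  under eq_fun do rewrite -linearBl; exact: (hcvg_ip u l v ul).
under eq_fun do rewrite -linearBl Im_dot; exact: hcvg_ip.
Qed.

Context (a : H -> H) (a_eff : effect dot a).
Context (b0 : H -> H) (b0_eff : effect dot b0) (b0Da : forall u, b0 u + a u = u).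
Let a_lin : linear a. Proof. by case: a_eff => [[]]. Qed.

Definition resid_seq n : H -> H := iter n (residual a) b0.
Local Notation b := resid_seq.
Local Notation P := (orth_proj dot [set xi | a xi = 0]).

Lemma resid_seq_admissible n : admissible dot a (b n).
Proof.
elim: n => [|n IH]; last exact: residual_admissible.
have b0E u : b0 u = u - a u by rewrite -{2}(b0Da u) addrK.
rewrite /resid_seq /=.
split=> //.
- by move=> u; rewrite !b0E (linearB_fun a_lin).
- by move=> u au; rewrite b0E au subr0.
- by exists 1; split=> // u; rewrite mul1r b0Da.
Qed.

Lemma resid_seq_effect n : effect dot (b n).
Proof. by case: (resid_seq_admissible n). Qed.

Lemma resid_seq_energy_le n u : ip (b n.+1 u) u <= ip (b n u) u.
Proof. exact: (residual_le dot dot_norm a a_eff (b n) (resid_seq_admissible n) u). Qed.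

Lemma resid_seq_energy_le0 n u : ip (b n u) u <= ip (b0 u) u.
Proof. by elim: n => // n; apply: le_trans (resid_seq_energy_le n u). Qed.

(** With p the n-th decrement, a (b n u) = (b n + a) (p u), and p u tends to 0
    because |p u|^2 <= (p u | u), the difference of two consecutive terms of a
    convergent sequence of energies. *)
Lemma resid_seq_limit_ker u l : hcvg dot (b^~ u) l -> a l = 0.
Proof.
move=> ul; apply/(sqnorm_eq0 dot)/le_anti; rewrite sqnorm_ge0 andbT.
pose x n := ip (b n u) u - ip (b n.+1 u) u.
have x0 : x n @[n --> \oo] --> (0 : R).
  pose y n := ip (b n u - l) u.
  have y0 : y n @[n --> \oo] --> (0 : R) by exact: (hcvg_ip (b^~ u)).
  have -> : x = (fun n => y n - y n.+1).
    by apply/funext => n; rewrite /x /y !rpairBl; lra.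
  rewrite -(subrr 0); apply: cvgB => //.
  by rewrite (cvg_shiftS y).
apply: (@cvg0_ge_const _ _ (fun n => 2 * sq (b n u - l) + 8 * x n)).
  move=> n; set p := b n u - b n.+1 u.
  have alE : a l = (b n p + a p) - a (b n u - l).
    have -> : b n p + a p = a (b n u).
      exact: (decrement_comm dot dot_norm a a_eff (b n) (resid_seq_admissible n) u).
    by rewrite (linearB_fun a_lin) opprB addrC subrK.
  have H1 := sqnormB_le2 dot (b n p + a p) (a (b n u - l)).
  have H2 := sqnormD_le2 dot (b n p) (a p).
  have leS T v : effect dot T -> sq (T v) <= sq v.
    by move=> Te; apply: le_trans (effect_sqnorm_le dot T v Te) _; case: Te.
  have H3 := leS (b n) p (resid_seq_effect n).
  have H4 := leS a p a_eff.
  have H5 := leS a (b n u - l) a_eff.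
  have := effect_sqnorm_le dot _ u
    (decrement_effect dot dot_norm a a_eff (b n) (resid_seq_admissible n)).
  rewrite -[(b n - _) u]/p /p rpairBl -/(x n) -/p => H6.
  rewrite alE; lra.
by apply: cvg0D; apply: cvg0Zl.
Qed.

(** Every term of the sequence is self-adjoint and fixes z. *)
Lemma resid_seq_limit_orth u l z :
  hcvg dot (b^~ u) l -> a z = 0 -> dot (u - l) z = 0.
Proof.
move=> ul az.
have ulz : dot (b n u) z @[n --> \oo] --> dot l z by exact: (hcvg_dot (b^~ u)).
have : dot u z = dot l z.
  apply/esym; apply: cvg_unique ulz _ => //.
  have -> : (fun n => dot (b n u) z) = fun=> dot u z.
    apply/funext => n; have [bp _] := resid_seq_effect n.
    rewrite (positive_herm dot (b n) bp) (adm_fix _ _ _ (resid_seq_admissible n)) //.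
    by rewrite (positive_herm dot id (positive_id dot)) conjcK.
  exact: cvg_cst.
by move=> uzlz; rewrite linearBl /= uzlz subrr.
Qed.

(** The existence of the projection comes from the limit of the residual
    sequence instead of a minimization argument. *)
Lemma orth_projP u : a (P u) = 0 /\ forall z, a z = 0 -> dot (u - P u) z = 0.
Proof.
have [l ul] :=
  effect_decreasing_cvg dot dot_norm _ resid_seq_effect resid_seq_energy_le u.
rewrite /orth_proj; case: xgetP => [eta _ [] //|/(_ l)[]]; split.
  exact: resid_seq_limit_ker ul.
by move=> z; exact: resid_seq_limit_orth.
Qed.

Lemma orth_proj_eq u l : a l = 0 ->
  (forall z, a z = 0 -> dot (u - l) z = 0) -> P u = l.
Proof.
move=> al ul; have [aP uP] := orth_projP u.
apply/eqP; rewrite -subr_eq0 -(dnorm_eq0 dot).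
have aPl : a (P u - l) = 0 by rewrite (linearB_fun a_lin) aP al subrr.
rewrite {1}(_ : P u - l = (u - l) - (u - P u)).
  by rewrite linearBl /= ul // uP // subrr.
by rewrite opprB [RHS]addrC addrA subrK.
Qed.

Lemma resid_seq_cvg u : hcvg dot (b^~ u) (P u).
Proof.
have [l ul] :=
  effect_decreasing_cvg dot dot_norm _ resid_seq_effect resid_seq_energy_le u.
rewrite (orth_proj_eq u l) //; first exact: resid_seq_limit_ker ul.
by move=> z; exact: resid_seq_limit_orth.
Qed.

Lemma orth_proj_positive : positive dot P.
Proof.
split=> [k u v|u].
  have [[aPu uP] [aPv vP]] := (orth_projP u, orth_projP v).
  apply: orth_proj_eq; first by rewrite a_lin aPu aPv scaler0 addr0.
  move=> z az; rewrite opprD addrACA -scalerBr linearDl linearZl_LR /=.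
  by rewrite uP // vP // mulr0 addr0.
have [aPu uP] := orth_projP u.
suff : 0 <= dot (P u) (u - P u) + dot (P u) (P u) by rewrite -linearDr /= subrK.
rewrite (positive_herm dot id (positive_id dot) (P u)) /= uP // conjc0 add0r.
exact: dnorm_ge0.
Qed.

(** As b n fixes P u, the space splits orthogonally for the energy of b n. *)
Lemma resid_seq_orth_energy n u :
  ip (b n (u - P u)) (u - P u) = ip (b n u) u - ip (P u) u.
Proof.
have [aPu uP] := orth_projP u; have [bp _] := resid_seq_effect n.
have bP := adm_fix _ _ _ (resid_seq_admissible n) _ aPu.
rewrite (quadB dot _ bp) bP (positive_rsym dot _ bp) bP.
have : ip (u - P u) (P u) = 0.
  exact: (congr1 (@complex.Re R) (uP _ aPu)).
by rewrite rpairBl (ipC dot u); lra.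
Qed.

Lemma orth_proj_energy_le n u : ip (P u) u <= ip (b n u) u.
Proof.
rewrite -subr_ge0 -resid_seq_orth_energy; have [bp _] := resid_seq_effect n.
exact: positive_quad_ge0.
Qed.

(** One step lowers the energy of b by that of its parallel sum with a, which
    [decrement_energy] at v = u bounds by the energy of a. *)
Lemma resid_seq_decrement_le n u : ip (b0 u) u - ip (b n u) u <= n%:R * ip (a u) u.
Proof.
elim: n => [|n IH]; first by rewrite subrr mul0r.
have := decrement_energy dot dot_norm a a_eff (b n) (resid_seq_admissible n) u u.
rewrite subrr /rpair linear0r add0r -/(rpair dot _ _) -!/(ip _ _).
have [bp _] := resid_seq_effect n; have [ap _] := a_eff.
set w := u - _; have := positive_quad_ge0 dot _ (positiveD dot _ _ bp ap) w.
rewrite -natr1 mulrDl mul1r rpairBl => H1 H2.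
by rewrite -/(rpair dot _ _) in H2 *; lra.
Qed.

End Projection.

(** * Transfer of operators to the anti-dual pair *)

Section Lifting.
Context {R : realType} {F E : lmodType R[i]} (pair : {pairing F, E on R[i]}).
Context {H : completeNormedModType R[i]}.
Context (dot : {dot H for (@Num.conj R[i])}) (dot_norm : hilbertian dot).
Local Notation C := (R[i] : numClosedFieldType).
Local Notation ip := (rpair dot).
Local Notation sq := (sqnorm dot).
Local Notation rp := (rpair pair).

Hypothesis pair_sep : forall f g : F, (forall x, pair f x = pair g x) -> f = g.
Context (J : H -> F) (K : E -> H).
Hypotheses (J_lin : linear J) (K_lin : linear K).
Hypothesis JK : forall xi x, pair (J xi) x = dot xi (K x).
Hypothesis K_dense : forall u (e : R), 0 < e -> exists x, sq (u - K x) < e.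

(** In the application K is the adjoint of J. *)
Definition transfer (T : H -> H) : E -> F := J \o T \o K.

Lemma rpair_transfer T x y : rp (transfer T x) y = ip (T (K x)) (K y).
Proof. by rewrite /rpair JK. Qed.

Lemma transfer_positive T : positive dot T -> positive pair (transfer T).
Proof.
move=> [Tl T0]; split=> [k x y|x]; first by rewrite /transfer /= K_lin Tl J_lin.
by rewrite /transfer /= JK; exact: T0.
Qed.

Lemma transferB S T : transfer (S - T) = transfer S - transfer T.
Proof. by apply/funext => x; exact: (linearB_fun J_lin). Qed.

Lemma parallel_sum_eq A B S :
  is_parallel_sum pair A B S -> parallel_sum pair A B = S.
Proof.
move=> Spar; apply: xget_unique => // S' S'par.
have [[[Sl _] Sinf] [[S'l _] S'inf]] := (Spar, S'par).
apply: (linear_eq_quad pair) => // x.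
exact: is_subset1_infimums (S'inf x) (Sinf x).
Qed.

Section Parallel.
Context (a : H -> H) (a_eff : effect dot a).
Context (b : H -> H) (b_adm : admissible dot a b).

(** The infimum over the vectors K y equals the minimum over H, as those vectors
    are dense and b + a is bounded. *)
Lemma transfer_parallel_sum :
  parallel_sum pair (transfer b) (transfer a) = transfer (b - residual a b).
Proof.
have [b_pos b_le] := adm_effect dot a b b_adm; have [a_pos a_le] := a_eff.
have [p_pos _] := decrement_effect dot dot_norm a a_eff b b_adm.
have [Lb La Lp] := And3 (transfer_positive b b_pos) (transfer_positive a a_pos)
   (transfer_positive _ p_pos).
have energyE x y : rp (transfer b (x - y)) (x - y) + rp (transfer a y) y =
    rp (transfer (b - residual a b) x) x +
    ip ((b + a) (K y - opinv (b + a) (b (K x))))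
       (K y - opinv (b + a) (b (K x))).
  rewrite !rpair_transfer (linearB_fun K_lin).
  exact: (decrement_energy dot dot_norm a a_eff b b_adm).
have T_pos : positive dot (b + a) by exact: positiveD.
apply: parallel_sum_eq; split=> // x; split.
  move=> _ [y _ <-]; rewrite !positive_quadE // -rmorphD lecR energyE lerDl.
  exact: positive_quad_ge0.
move=> z zlb.
have zle y : Im z = 0 /\
    Re z <= rp (transfer b (x - y)) (x - y) + rp (transfer a y) y.
  have : z <= pair (transfer b (x - y)) (x - y) + pair (transfer a y) y.
    by apply: zlb; exists y.
  by rewrite !positive_quadE // -rmorphD lecE /= => /andP[/eqP <-].
have [z0 _] := zle 0.
rewrite positive_quadE // lecE /= z0 eqxx /=.
apply/ler_addgt0Pr => e e0; set w := opinv (b + a) (b (K x)).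
have [|y wy] := K_dense w (e / 2); first by rewrite divr_gt0.
have [_ zley] := zle y; apply: le_trans zley _; rewrite energyE -/w lerD2l.
have : ip ((b + a) (K y - w)) (K y - w) <= 2 * sq (K y - w).
  rewrite -[(b + a) _]/(b (K y - w) + a (K y - w)) rpairDl.
  by have := a_le (K y - w); have := b_le (K y - w); lra.
have := sqnormN dot (K y - w); rewrite opprB; lra.
Qed.

End Parallel.

Context (a : H -> H) (a_eff : effect dot a).
Context (b0 : H -> H) (b0_eff : effect dot b0) (b0Da : forall u, b0 u + a u = u).
Local Notation b := (resid_seq a b0).
Local Notation P := (orth_proj dot [set xi | a xi = 0]).
Let P_pos : positive dot P.
Proof. exact: (orth_proj_positive dot dot_norm a a_eff b0 b0_eff b0Da). Qed.
Let b_adm := resid_seq_admissible dot dot_norm a a_eff b0 b0_eff b0Da.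

Lemma transfer_residual_seq n :
  residual_seq pair (transfer a) (transfer b0) n = transfer (b n).
Proof.
elim: n => [//|n IH] /=; rewrite IH transfer_parallel_sum //.
by rewrite -transferB; congr transfer; rewrite opprB addrC subrK.
Qed.

Lemma transfer_strong_limit :
  strong_limit pair (residual_seq pair (transfer a) (transfer b0)) = transfer P.
Proof.
have Plim x y : (pair (residual_seq pair (transfer a) (transfer b0) n x) y : C)
    @[n --> \oo] --> (pair (transfer P x) y : C).
  under eq_fun do rewrite transfer_residual_seq /transfer /= JK.
  rewrite /transfer /= JK; apply: (hcvg_dot dot (fun n => b n (K x))).
  exact: (resid_seq_cvg dot dot_norm a a_eff b0 b0_eff b0Da).
apply: xget_unique; first by split=> //; exact: transfer_positive.
move=> S [_ Slim]; apply/funext => x; apply: pair_sep => y.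
exact: cvg_unique (Slim x y) (Plim x y).
Qed.

(** The operator is an increasing limit of operators dominated by multiples of
    the transfer of a. *)
Lemma transfer_ac_minorant :
  ac_minorant pair (transfer a) (transfer b0) (transfer (b0 - P)).
Proof.
have [[b0_pos b0_le] [a_pos _]] := (b0_eff, a_eff).
have P_le n u := orth_proj_energy_le dot dot_norm a a_eff b0 b0_eff b0Da n u.
have D_pos : positive dot (b0 - P) by apply: positiveB => // u; exact: (P_le 0%N).
have LD := transfer_positive _ D_pos; have La := transfer_positive _ a_pos.
have Lb0 := transfer_positive _ b0_pos.
split=> //.
  apply/le_opP => // x; rewrite !rpair_transfer -[(b0 - P) _]/(b0 (K x) - P (K x)).
  by rewrite rpairBl lerBlDr lerDl; exact: positive_quad_ge0.
move=> x.
have -> : (fun n => pair (transfer a (x n)) (x n))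
    = (fun n => (rp (transfer a (x n)) (x n))%:C : C).
  by apply/funext => n; rewrite positive_quadE.
have -> : (fun n => pair (transfer (b0 - P) (x n)) (x n))
    = (fun n => (rp (transfer (b0 - P) (x n)) (x n))%:C : C).
  by apply/funext => n; rewrite positive_quadE.
have -> : (fun nm : nat * nat =>
      pair (transfer (b0 - P) (x nm.1 - x nm.2)) (x nm.1 - x nm.2))
    = (fun nm => (rp (transfer (b0 - P) (x nm.1 - x nm.2)) (x nm.1 - x nm.2))%:C : C).
  by apply/funext => n; rewrite positive_quadE.
move=> /cvg_real_complex a0 /cvg_real_complex D0; apply/cvg_real_complex.
apply/cvgrPdist_lt => e e0.
have e4 : 0 < e / 4 by rewrite divr_gt0.
have [[U V] /= [[N1 _ NU] [N2 _ NV]] UV] := cvgr_lt _ D0 _ e4.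
exists N1 => // n Nn.
rewrite sub0r normrN ger0_norm; last exact: positive_quad_ge0.
apply: (@le_lt_trans _ _ (e / 2)); last by rewrite ltr_pdivrMr // ltr_pMr // ltr1n.
have qle k : rp (transfer (b0 - b k) (x n)) (x n) <= e / 2.
  (* for fixed k, a term far out in the sequence serves as comparison point *)
  have [q_pos _] : effect dot (b0 - b k).
    apply: effectB => // [|u].
      exact: (resid_seq_effect dot dot_norm a a_eff b0 b0_eff b0Da).
    exact: (resid_seq_energy_le0 dot dot_norm a a_eff b0 b0_eff b0Da).
  have Lq := transfer_positive _ q_pos.
  rewrite -subr_le0.
  apply: (@cvg0_ge_const _ _
      (fun m => 2 * k%:R * rp (transfer a (x (N2 + m)%N)) (x (N2 + m)%N))).
    move=> m; set y := x (N2 + m)%N.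
    have H1 := quadD_le2 pair _ Lq (x n - y) y; rewrite subrK in H1.
    have H2 : rp (transfer (b0 - P) (x n - y)) (x n - y) < e / 4.
      by apply: (UV (n, (N2 + m)%N)); split; [exact: NU|apply: NV; exact: leq_addr].
    have H3 : rp (transfer (b0 - b k) (x n - y)) (x n - y)
        <= rp (transfer (b0 - P) (x n - y)) (x n - y).
      rewrite !rpair_transfer -[(b0 - P) _]/(b0 _ - P _) -[(b0 - b k) _]/(b0 _ - b k _).
      by rewrite !rpairBl lerD2l lerN2.
    have H4 : rp (transfer (b0 - b k) y) y <= k%:R * rp (transfer a y) y.
      rewrite !rpair_transfer -[(b0 - b k) _]/(b0 _ - b k _) rpairBl.
      exact: (resid_seq_decrement_le dot dot_norm a a_eff b0 b0_eff b0Da).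
    lra.
  apply: cvg0Zl.
  have : rp (transfer a (x (m + N2)%N)) (x (m + N2)%N) @[m --> \oo] --> (0 : R).
    by rewrite (cvg_shiftn N2 (fun m => rp (transfer a (x m)) (x m))).
  by under eq_fun do rewrite addnC.
rewrite -subr_le0.
apply: (@cvg0_ge_const _ _ (fun k => ip (b k (K (x n)) - P (K (x n))) (K (x n)))).
  move=> k; have := qle k; rewrite !rpair_transfer.
  rewrite -[(b0 - P) _]/(b0 _ - P _) -[(b0 - b k) _]/(b0 _ - b k _) !rpairBl; lra.
apply: (hcvg_ip dot (fun k => b k (K (x n)))).
exact: (resid_seq_cvg dot dot_norm a a_eff b0 b0_eff b0Da).
Qed.

(** Absolute continuity makes D blind to the component of K x in ker a: a
    sequence K (y n) approaching P (K x) has D-energy tending to 0, so x may be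
    replaced by x - y n, and there D is bounded by b0. *)
Lemma transfer_ac_maximal D : ac_minorant pair (transfer a) (transfer b0) D ->
  le_op pair D (transfer (b0 - P)).
Proof.
move=> [D_pos Dle Dac].
have [[b0_pos b0_le] [a_pos a_le]] := (b0_eff, a_eff).
have P_le n u := orth_proj_energy_le dot dot_norm a a_eff b0 b0_eff b0Da n u.
have D0_pos : positive dot (b0 - P) by apply: positiveB => // u; exact: (P_le 0%N).
have [La Lb0] := (transfer_positive a a_pos, transfer_positive b0 b0_pos).
move/(le_opP pair _ _ D_pos Lb0) in Dle.
apply/le_opP => //; first exact: transfer_positive.
move=> x; set u := K x; pose t := ip (b0 (u - P u)) (u - P u).
have -> : rp (transfer (b0 - P) x) x = t.
  rewrite rpair_transfer -[(b0 - P) _]/(b0 _ - P _) rpairBl.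
  exact/esym/(resid_seq_orth_energy dot dot_norm a a_eff b0 b0_eff b0Da 0%N).
have t0 : 0 <= t by exact: positive_quad_ge0.
have [aPu _] := orth_projP dot dot_norm a a_eff b0 b0_eff b0Da u.
have /choice[y yP] n : exists y, sq (P u - K y) < n.+1%:R^-1.
  by apply: K_dense; rewrite invr_gt0.
have sq0 : sq (P u - K (y n)) @[n --> \oo] --> (0 : R).
  apply: (cvg0_le _ (@harmonic R)) cvg_harmonic => n; first exact: sqnorm_ge0.
  exact/ltW/yP.
have Dy0 : rp (D (y n)) (y n) @[n --> \oo] --> (0 : R).
  apply/cvg_real_complex.
  have -> : (fun n => (rp (D (y n)) (y n))%:C : C)
      = (fun n => pair (D (y n)) (y n)).
    by apply/funext => n; rewrite positive_quadE.
  apply: Dac.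
    have -> : (fun n => pair (transfer a (y n)) (y n))
        = (fun n => (rp (transfer a (y n)) (y n))%:C : C).
      by apply/funext => n; rewrite positive_quadE.
    (* as a (P u) = 0, the energy of a at K (y n) is that at P u - K (y n) *)
    apply/cvg_real_complex; apply: (cvg0_le _ _ _ _ sq0) => n.
      exact: positive_quad_ge0.
    rewrite rpair_transfer; have [a_lin _] := a_pos.
    have := a_le (P u - K (y n)).
    rewrite (quadB dot a a_pos) aPu /rpair !linear0l /= mulr0 subr0 add0r.
    by [].
  have -> : (fun nm : nat * nat =>
        pair (D (y nm.1 - y nm.2)) (y nm.1 - y nm.2))
      = (fun nm => (rp (D (y nm.1 - y nm.2)) (y nm.1 - y nm.2))%:C : C).
    by apply/funext => n; rewrite positive_quadE.
  apply/cvg_real_complex/cvgrPdist_lt => e e0.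
  have e4 : 0 < e / 4 by rewrite divr_gt0.
  have [N _ NP] := cvgr_lt _ sq0 _ e4.
  exists ([set n | (N <= n)%N], [set n | (N <= n)%N]); first by split; exists N.
  move=> [n m] /= [/NP nP /NP mP].
  rewrite sub0r normrN ger0_norm; last exact: positive_quad_ge0.
  apply: le_lt_trans (Dle _) _; rewrite rpair_transfer; apply: le_lt_trans (b0_le _) _.
  rewrite (linearB_fun K_lin).
  have := sqnormB_le2 dot (P u - K (y m)) (P u - K (y n)).
  rewrite opprB [X in sq X](_ : _ = K (y n) - K (y m)); first lra.
  by rewrite addrC addrA subrK.
apply/ler_addgt0Pr => d d0.
have td : 0 < 3 * t + d by rewrite ltr_wpDl // mulr_ge0.
(* this e satisfies e <= 1 and 3 e t <= d, whence (1 + e)^2 t <= t + d *)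
pose e := d / (3 * t + d).
have e0 : 0 < e by rewrite divr_gt0.
have e1 : e <= 1 by rewrite ler_pdivrMr // mul1r lerDr mulr_ge0.
have et : e * (3 * t + d) = d by rewrite divfK // gt_eqF.
suff : rp (D x) x <= (1 + e) * ((1 + e) * t).
  have := ler_wpM2r t0 (ler_wpM2l (ltW e0) e1).
  have : 0 <= e * d by rewrite mulr_ge0 // ltW.
  lra.
rewrite -subr_le0.
apply: (@cvg0_ge_const _ _ (fun n => (1 + e) * (1 + e^-1) * sq (P u - K (y n))
  + (1 + e^-1) * rp (D (y n)) (y n))); last by apply: cvg0D; apply: cvg0Zl.
move=> n.
have H1 := quadD_le pair D D_pos e (x - y n) (y n) e0; rewrite subrK in H1.
have H2 := Dle (x - y n); rewrite rpair_transfer (linearB_fun K_lin) -/u in H2.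
have H3 := quadD_le dot b0 b0_pos e (u - P u) (P u - K (y n)) e0.
rewrite addrA subrK -/t in H3.
have H4 := b0_le (P u - K (y n)).
have ei : 0 < 1 + e^-1 by rewrite addr_gt0 // invr_gt0.
have H5 := ler_wpM2l (ltW ei) H4.
have ep : 0 <= 1 + e by rewrite addr_ge0 // ltW.
have H6 := ler_wpM2l ep (le_trans H2 (le_trans H3 (lerD (lexx _) H5))).
move: H1 H6; rewrite mulrDr !mulrA; lra.
Qed.

Lemma transfer_ac_part :
  ac_part pair (transfer a) (transfer b0) = transfer (b0 - P).
Proof.
apply: xget_unique => [|D [Dmin Dmax]].
  by split; [exact: transfer_ac_minorant|exact: transfer_ac_maximal].
have [[[Dl _] _ _] [[Ll _] _ _]] := (Dmin, transfer_ac_minorant).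
apply: (linear_eq_quad pair) => // x; apply: le_anti.
by rewrite (transfer_ac_maximal D Dmin) (Dmax _ transfer_ac_minorant).
Qed.

End Lifting.

(** * The embedding and dense ranges *)

Section Embedding.
Context {R : realType} {F E : lmodType R[i]} (pair : {pairing F, E on R[i]}).
Context {H : completeNormedModType R[i]}.
Context (dot : {dot H for (@Num.conj R[i])}) (dot_norm : hilbertian dot).
Local Notation C := (R[i] : numClosedFieldType).
Local Notation sq := (sqnorm dot).

(** Norm convergence implies pointwise convergence of the functionals. *)
Lemma hcvg_weak u l : hcvg dot u l ->
  (u n : weak_space dot) @[n --> \oo] --> (l : weak_space dot).
Proof.
move=> ul.
have dotl : {ptws, (fun n => (dot (u n) : H -> C)) @ \oo --> (dot l : H -> C)}.
  by apply/pointwise_cvgP => v; exact: (hcvg_dot dot u l v ul).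
move=> A [_ [[W oW <-] Wl WA]].
have : nbhs (dot l : prod_topology (fun _ : H => C)) W by exact: open_nbhs_nbhs.
by move=> /dotl[N _ NW]; exists N => // n /NW; exact: WA.
Qed.

(** Both sides are sequentially continuous for the norm, the left one because
    norm convergence implies weak convergence. *)
Lemma weakly_continuous_dense_eq (J : H -> F) (D : set H) (x : E) (eta : H) :
  continuous (J : weak_space dot -> weak_space pair) -> dense D ->
  (forall d, D d -> pair (J d) x = dot d eta) ->
  forall xi, pair (J xi) x = dot xi eta.
Proof.
move=> Jcont Dd JD xi.
have /choice[u uP] n : exists d, D d /\ sq (xi - d) < n.+1%:R^-1.
  have [|d Dd' xd] := sqnorm_dense dot dot_norm D Dd xi n.+1%:R^-1.
    by rewrite invr_gt0.
  by exists d.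
have ul : hcvg dot u xi.
  apply: (cvg0_le _ (@harmonic R)) cvg_harmonic => n; first exact: sqnorm_ge0.
  by rewrite -sqnormN opprB; apply: ltW; case: (uP n).
have Jl : (pair (J (u n)) x : C) @[n --> \oo] --> (pair (J xi) x : C).
  have evx := @proj_continuous E (fun=> (C : topologicalType)) x (pair (J xi)).
  have Ju := cvg_comp _ _ (hcvg_weak u xi ul) (Jcont xi).
  have pJu := cvg_comp _ _ Ju
    (@initial_continuous F _ (fun f => pair f : prod_topology (fun _ : E => C))
       (J xi)).
  exact: cvg_comp pJu evx.
have ul' : (dot (u n) eta : C) @[n --> \oo] --> (dot xi eta : C) by exact: hcvg_dot.
apply: cvg_unique Jl _ => //.
have -> : (fun n => pair (J (u n)) x) = (fun n => dot (u n) eta) => //.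
by apply/funext => n; apply: JD; case: (uP n).
Qed.

End Embedding.

Section DenseRange.
Context {R : realType} {E : lmodType R[i]} {H : completeNormedModType R[i]}.
Context (dot : {dot H for (@Num.conj R[i])}) (dot_norm : hilbertian dot).
Local Notation sq := (sqnorm dot).
Context (K : E -> H).
Hypothesis K_dense : forall u (e : R), 0 < e -> exists x, sq (u - K x) < e.

Lemma orth_dense_eq0 u : (forall x, dot u (K x) = 0) -> u = 0.
Proof.
move=> uK; apply/(sqnorm_eq0 dot)/le_anti; rewrite sqnorm_ge0 andbT.
apply/ler_addgt0Pr => e e0; rewrite add0r; have [x xe] := K_dense u e e0.
apply: ltW; apply: le_lt_trans xe; rewrite sqnormB.
have -> : rpair dot u (K x) = 0 by exact: (congr1 (@complex.Re R) (uK x)).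
by rewrite mulr0 subr0 lerDl sqnorm_ge0.
Qed.

Lemma bounded_dense_eq0 (r : H -> H) (k : R) : linear r ->
  (forall u, sq (r u) <= k * sq u) -> (forall x, r (K x) = 0) -> forall u, r u = 0.
Proof.
move=> r_lin r_le rK u.
apply/(sqnorm_eq0 dot)/le_anti; rewrite sqnorm_ge0 andbT.
apply/ler_addgt0Pr => e e0; rewrite add0r.
have k0 : 0 < `|k| + 1 by rewrite ltr_wpDl.
have [|x xe] := K_dense u (e / (`|k| + 1)); first by rewrite divr_gt0.
have -> : r u = r (u - K x) by rewrite (linearB_fun r_lin) rK subr0.
rewrite ltr_pdivlMr // mulrC in xe; apply: le_trans (r_le _) (le_trans _ (ltW xe)).
by apply: ler_wpM2r; rewrite ?sqnorm_ge0 // (le_trans (ler_norm k)) // lerDl.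
Qed.

Lemma contraction_sqnorm_le (T : H -> H) : positive_contraction dot T ->
  forall u, sq (T u) <= sq u.
Proof.
move=> [_ _ Tle] u; have : `|T u| ^+ 2 <= `|u| ^+ 2.
  by rewrite lerXn2r ?nnegrE ?normr_ge0.
by rewrite !dot_norm !dot_sqnorm // lecR.
Qed.

Lemma dense_add_id (S T : H -> H) : positive_contraction dot S ->
  positive_contraction dot T -> (forall x, S (K x) + T (K x) = K x) ->
  forall u, S u + T u = u.
Proof.
move=> Sc Tc STK u; have [[Sl _ _] [Tl _ _]] := (Sc, Tc).
apply/eqP; rewrite -subr_eq0; apply/eqP.
apply: (bounded_dense_eq0 (fun u => S u + T u - u) 10) => [k v w|v|x].
- by rewrite Sl Tl addrACA -scalerDr opprD addrACA -scalerBr.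
- have := contraction_sqnorm_le S Sc v; have := contraction_sqnorm_le T Tc v.
  have := sqnormD_le2 dot (S v) (T v); have := sqnormB_le2 dot (S v + T v) v.
  lra.
- by rewrite STK subrr.
Qed.

End DenseRange.

(** * The absolutely continuous part *)

Theorem theorem3p4 (R : realType) (F E : lmodType R[i])
    (pair : {pairing F, E on R[i]})
    (pair_sep : separating pair)
    (pair_complete : wstar_seq_complete pair)
    (A B : E -> F) (A_pos : positive pair A) (B_pos : positive pair B)
    (H : completeNormedModType R[i]) (dot : {dot H for (@Num.conj R[i])})
    (H_hilbert : hilbertian dot)
    (iota : F -> H) (H_completion : is_completion pair dot (A + B) iota)
    (J : H -> F) (J_embedding : is_embedding pair dot (A + B) iota J)
    (At Bt : H -> H)
    (At_contr : positive_contraction dot At)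
    (Bt_contr : positive_contraction dot Bt)
    (A_fact : A = J \o At \o adjoint pair dot J)
    (B_fact : B = J \o Bt \o adjoint pair dot J) :
  let P := orth_proj dot [set xi | At xi = 0] in
  let Bs := strong_limit pair (residual_seq pair A B) in
  ac_part pair A B = J \o (Bt - P) \o adjoint pair dot J /\
  J \o (Bt - P) \o adjoint pair dot J = B - Bs.
Proof.
have [sepF _] := pair_sep.
have [iota_lin iota_dot iota_dense] := H_completion.
have [J_lin J_cont J_iota] := J_embedding.
have [K KE] : exists K : E -> H, forall x, K x = iota ((A + B) x).
  by exists (iota \o (A + B)).
have ranC x : range (A + B) ((A + B) x) by exists x.
have C_lin : linear (A + B) by case: (positiveD pair A B A_pos B_pos).
have K_lin : linear K by move=> k x y; rewrite !KE C_lin iota_lin.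
have JK xi x : pair (J xi) x = dot xi (K x).
  apply: (weakly_continuous_dense_eq pair dot H_hilbert J _ x (K x) J_cont iota_dense).
  by move=> _ [_ [y _ <-] <-]; rewrite J_iota // KE iota_dot.
have K_dense u (e : R) : 0 < e -> exists x, sqnorm dot (u - K x) < e.
  move=> e0.
  have [_ [_ [x _ <-] <-] xe] := sqnorm_dense dot H_hilbert _ iota_dense u e e0.
  by exists x; rewrite KE.
have adjE : adjoint pair dot J = K.
  apply/funext => x; apply: xget_unique => [xi|eta etaP]; first exact: JK.
  apply/eqP; rewrite -subr_eq0 -(dnorm_eq0 dot).
  by rewrite linearBr /= -JK -etaP subrr.
rewrite adjE in A_fact B_fact *.
have At_pos : positive dot At by case: At_contr.
have Bt_pos : positive dot Bt by case: Bt_contr.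
(* after J both sides agree on the dense range of K, and J is injective *)
have BtDAt u : Bt u + At u = u.
  apply: (dense_add_id dot H_hilbert K K_dense Bt At Bt_contr At_contr) => x.
  apply/eqP; rewrite -subr_eq0; apply/eqP/(orth_dense_eq0 dot K K_dense) => y.
  rewrite -JK (linearB_fun J_lin) (linearD_fun J_lin).
  have -> : J (K x) = A x + B x by rewrite KE J_iota.
  rewrite [in A x]A_fact [in B x]B_fact /=.
  by rewrite [J (At _) + _]addrC subrr linear0l.
have At_eff : effect dot At.
  split=> // u; rewrite /sqnorm -{3}(BtDAt u) rpairDl lerDr.
  exact: positive_quad_ge0.
have Bt_eff : effect dot Bt.
  split=> // u; rewrite /sqnorm -{3}(BtDAt u) rpairDl lerDl.
  exact: positive_quad_ge0.
have {A_fact}AE : A = transfer J K At by exact: A_fact.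
have {B_fact}BE : B = transfer J K Bt by exact: B_fact.
move=> P Bs; rewrite {}/Bs AE BE; split.
  exact: (transfer_ac_part pair dot H_hilbert sepF J K J_lin K_lin JK K_dense
            At At_eff Bt Bt_eff BtDAt).
rewrite (transfer_strong_limit pair dot H_hilbert sepF J K J_lin K_lin JK K_dense
            At At_eff Bt Bt_eff BtDAt).
exact: (transferB J K J_lin).
Qed.
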